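(* Let $(K,\delta)\subseteq(L,\delta)$ be a differential field extension with $L=K(\bar a)_\delta$ for some $n$-tuple $\bar a=(a_1,\dots,a_n)$ from $L$. Then the set of minimal-separable leaders of $L$ is finite. Furthermore, if the field extension $L/K$ is separable, then the set of inseparable leaders of $L$ is also finite.
   Context: Fields are of arbitrary characteristic. $K(\bar a)_\delta$ is the differential field generated by $\bar a$ over $K$, i.e. $K(\delta^\xi a_i:\xi\in\mathbb{N}_0,1\le i\le n)$. Write $a_i^\xi=\delta^\xi a_i$ and order pairs $(\xi,i)\in\mathbb{N}_0\times\{1,\dots,n\}$ lexicographically by $\trianglelefteq$. The element $a_j^\tau$ (understood as indexed by $(\tau,j)$) is a leader of $L$ if it is algebraic over $K(a_i^\xi:(\xi,i)\triangleleft(\tau,j))$; a separable leader if it is separably algebraic over that field, and an inseparable leader if it is a leader but not separable; a minimal-separable leader if it is a separable leader and there is no separable leader $a_j^\xi$ with $\xi<\tau$. *)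

(* Defs.v *)
From mathcomp Require Import all_boot all_order all_algebra all_field.
From mathcomp Require Import all_classical.

Set Implicit Arguments.
Unset Strict Implicit.
Unset Printing Implicit Defensive.

Import Order.TTheory GRing.Theory.
Local Open Scope classical_set_scope.
Local Open Scope ring_scope.

Definition is_derivation (L : fieldType) (delta : L -> L) : Prop :=
  (forall x y, delta (x + y) = delta x + delta y) /\
  (forall x y, delta (x * y) = delta x * y + x * delta y).

Definition is_subfield (L : fieldType) (F : set L) : Prop :=
  divring_closed [in F].

Definition is_diff_subfield (L : fieldType) (delta : L -> L) (K : set L)
    : Prop :=
  is_subfield K /\ (forall x, K x -> K (delta x)).

(* The field K(S). *)
Definition adjoin (L : fieldType) (K S : set L) : set L :=
  smallest (@is_subfield L) (K `|` S).

Definition poly_over (L : fieldType) (F : set L) (p : {poly L}) : Prop :=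
  forall k : nat, F p`_k.

Definition algebraic_over (L : fieldType) (F : set L) (x : L) : Prop :=
  exists p : {poly L}, [/\ p != 0, poly_over F p & root p x].

Definition is_minpoly (L : fieldType) (F : set L) (x : L) (p : {poly L})
    : Prop :=
  [/\ p \is monic, poly_over F p, root p x &
      forall q : {poly L}, q != 0 -> poly_over F q -> root q x ->
        (size p <= size q)%N].

Definition separable_over (L : fieldType) (F : set L) (x : L) : Prop :=
  exists p : {poly L}, is_minpoly F x p /\ separable_poly p.

Definition lin_indep (L : fieldType) (F : set L) (m : nat) (x : 'I_m -> L)
    : Prop :=
  forall c : 'I_m -> L, (forall i, F (c i)) ->
    \sum_(i < m) c i * x i = 0 -> forall i, c i = 0.

Definition lin_disjoint (L : fieldType) (C A B : set L) : Prop :=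
  forall (m : nat) (x : 'I_m -> L),
    (forall i, A (x i)) -> lin_indep C x -> lin_indep B x.

(* Separability of a not necessarily algebraic extension L/K: in               *)
(* characteristic p > 0, K and L^p are linearly disjoint over K^p (the image   *)
(* under Frobenius of "K^{1/p} and L are linearly disjoint over K"); in        *)
(* characteristic 0 there is no condition.                                     *)
Definition separable_extension (L : fieldType) (K : set L) : Prop :=
  forall p : nat, p \in [pchar L] ->
    lin_disjoint [set x ^+ p | x in K] K [set x ^+ p | x in [set: L]].

Section Leaders.
Variables (L : fieldType) (delta : L -> L) (K : set L) (n : nat).
Variable a : 'I_n -> L.

(* Pairs (xi, i) with the lexicographic order; i ranges over 0, ..., n - 1.    *)
Definition jet (p : nat *l 'I_n) : L := iter p.1 delta (a p.2).

Definition diff_adjoin : set L := adjoin K (range jet).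

Definition preceding_field (p : nat *l 'I_n) : set L :=
  adjoin K [set jet q | q in [set q : nat *l 'I_n | (q < p)%O]].

(* Leaders are identified with their index p rather than with the element     *)
(* jet p of L, as distinct indices may give the same element.                  *)
Definition leader (p : nat *l 'I_n) : Prop :=
  algebraic_over (preceding_field p) (jet p).

Definition separable_leader (p : nat *l 'I_n) : Prop :=
  separable_over (preceding_field p) (jet p).

Definition inseparable_leader (p : nat *l 'I_n) : Prop :=
  leader p /\ ~ separable_leader p.

Definition minimal_separable_leader (p : nat *l 'I_n) : Prop :=
  separable_leader p /\
  ~ (exists xi : nat, (xi < p.1)%N /\ separable_leader (xi, p.2)).

End Leaders.

(* Main.v *)
(* In characteristic 0 every leader is separable, and for each [j] there is at
   most one minimal-separable leader [(tau, j)]; the substance is the finiteness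
   of the inseparable leaders in characteristic [p].

   Call [(tau, j)] rational if [a_j^tau] lies in the field preceding it; applying
   [delta] shows that [(tau + 1, j)] is then rational.  Let [V] be the set of
   those [(tau, j)] for which no [(xi, j)] is rational.  If [(tau, j)] is in [V],
   then [a_j^tau] is not in [K L^p(preceding jets)]: otherwise, only p-th powers of
   finitely many jets are involved, [delta] kills them, and after enough
   derivations they all belong to the preceding field, so that some [(xi, j)]
   would be rational.  Hence [V] is p-independent over [K], and by separability
   of [L/K] it is algebraically independent over [K].  All remaining jets are
   rational over the preceding ones, up to finitely many.  Adjoining those
   finitely many elements to [K], one at a time, makes only finitely many
   elements of [V] algebraic over the preceding ones, by the exchange property. *)

From HB Require Import structures.
Require Import Defs.
From mathcomp Require Import all_boot all_order all_algebra all_field.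
From mathcomp Require Import all_classical.

Set Implicit Arguments.
Unset Strict Implicit.
Unset Printing Implicit Defensive.

Import Order.TTheory GRing.Theory.
Local Open Scope classical_set_scope.
Local Open Scope ring_scope.

(** * Field types carried by subfields *)

Section SubfieldType.
Variables (L : fieldType) (F : set L) (hF : is_subfield F).

(** The closure proof is an argument so that the instance below can be attached to the predicate. *)
Definition subfield_pred of is_subfield F : {pred L} := [in F].
HB.instance Definition _ :=
  GRing.isDivringClosed.Build L (subfield_pred hF) hF.

Record subfield_sort :=
  SubfieldSort {subfield_val :> L; _ : subfield_val \in subfield_pred hF}.
HB.instance Definition _ := [isSub for subfield_val].
HB.instance Definition _ := [Choice of subfield_sort by <:].
HB.instance Definition _ :=
  [SubChoice_isSubIntegralDomain of subfield_sort by <:].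
HB.instance Definition _ := [SubIntegralDomain_isSubField of subfield_sort by <:].

End SubfieldType.

(** * Subfields as sets, polynomials over them, adjunction *)

Section Subfields.
Variable L : fieldType.
Implicit Types F : set L.

(** Seeing a subfield as the range of a morphism transports results on [map_poly], gcds and
    [algebraicOver] to sets. *)
Lemma subfield_embedding F : is_subfield F ->
  exists (E : fieldType) (f : {rmorphism E -> L}), range f = F.
Proof.
move=> hF; exists (subfield_sort hF), \val.
apply/seteqP; split=> [_ [x _ <-]|x Fx]; first by have /set_mem := valP x.
by exists (SubfieldSort (hF := hF) (mem_set Fx)).
Qed.

Lemma poly_over_range (E : fieldType) (f : {rmorphism E -> L}) (p : {poly L}) :
  poly_over (range f) p -> exists q : {poly E}, p = map_poly f q.
Proof.
move=> fp; have /choice[g gp] : forall i, exists c, f c = p`_i.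
  by move=> i; have [c _ <-] := fp i; exists c.
exists (\poly_(i < size p) g i).
apply/polyP => i; rewrite coef_map coef_poly.
case: ltnP => [_|/(nth_default 0)->]; first exact/esym/gp.
by rewrite raddf0.
Qed.

Lemma poly_over_map (E : fieldType) (f : {rmorphism E -> L}) (q : {poly E}) :
  poly_over (range f) (map_poly f q).
Proof. by move=> i; rewrite coef_map; exists q`_i. Qed.

Lemma algebraic_over_range (E : fieldType) (f : {rmorphism E -> L}) x :
  algebraic_over (range f) x <-> algebraicOver f x.
Proof.
split=> [[p [p0 /poly_over_range[q pq] px]]|[q q0 qx]].
  by exists q; rewrite -?pq// -(map_poly_eq0 f) -pq.
by exists (map_poly f q); split; [rewrite map_poly_eq0|exact: poly_over_map|].
Qed.

Section Closure.
Variables (F : set L) (hF : is_subfield F).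
Implicit Types (x y : L) (p q : {poly L}).

Lemma subfield1 : F 1. Proof. by case: hF => /set_mem. Qed.

Lemma subfieldB x y : F x -> F y -> F (x - y).
Proof. by case: hF => _ hB _ /mem_set Fx /mem_set Fy; apply/set_mem/hB. Qed.

Lemma subfieldDiv x y : F x -> F y -> F (x / y).
Proof. by case: hF => _ _ hV /mem_set Fx /mem_set Fy; apply/set_mem/hV. Qed.

Lemma subfield0 : F 0.
Proof. by rewrite -(subrr 1); apply: subfieldB; apply: subfield1. Qed.

Lemma subfieldN x : F x -> F (- x).
Proof. by move=> Fx; rewrite -sub0r; apply: subfieldB => //; apply: subfield0. Qed.

Lemma subfieldD x y : F x -> F y -> F (x + y).
Proof. by move=> Fx Fy; rewrite -(opprK y); apply/subfieldB/subfieldN. Qed.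

Lemma subfieldV x : F x -> F x^-1.
Proof. by move=> Fx; rewrite -div1r; apply: subfieldDiv => //; apply: subfield1. Qed.

Lemma subfieldM x y : F x -> F y -> F (x * y).
Proof. by move=> Fx Fy; rewrite -(invrK y); apply/subfieldDiv/subfieldV. Qed.

Lemma subfieldX x n : F x -> F (x ^+ n).
Proof.
by move=> Fx; elim: n => [|n IHn]; rewrite ?exprS; [exact: subfield1|exact: subfieldM].
Qed.

Lemma subfieldMn x n : F x -> F (x *+ n).
Proof.
by move=> Fx; elim: n => [|n IHn]; rewrite ?mulrS; [exact: subfield0|exact: subfieldD].
Qed.

Lemma subfield_sum (I : Type) (r : seq I) (P : pred I) (f : I -> L) :
  (forall i, P i -> F (f i)) -> F (\sum_(i <- r | P i) f i).
Proof. by move=> Ff; elim/big_ind : _ => //; [exact: subfield0|exact: subfieldD]. Qed.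

Lemma poly_overX : poly_over F 'X.
Proof. by move=> k; rewrite coefX; case: eqP => _; [exact: subfield1|exact: subfield0]. Qed.

Lemma poly_overC c : F c -> poly_over F c%:P.
Proof. by move=> Fc k; rewrite coefC; case: eqP => _ //; exact: subfield0. Qed.

Lemma poly_overB p q : poly_over F p -> poly_over F q -> poly_over F (p - q).
Proof. by move=> Fp Fq k; rewrite coefB; apply: subfieldB. Qed.

Lemma poly_overM p q : poly_over F p -> poly_over F q -> poly_over F (p * q).
Proof. by move=> Fp Fq k; rewrite coefM; apply: subfield_sum => i _; apply: subfieldM. Qed.

Lemma poly_over_prod (I : Type) (r : seq I) (P : pred I) (f : I -> {poly L}) :
  (forall i, P i -> poly_over F (f i)) -> poly_over F (\prod_(i <- r | P i) f i).
Proof.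
move=> Ff; elim/big_ind : _ => //; last exact: poly_overM.
by rewrite -polyC1; apply/poly_overC/subfield1.
Qed.

Lemma poly_over_poly n (c : nat -> L) :
  (forall i, (i < n)%N -> F (c i)) -> poly_over F (\poly_(i < n) c i).
Proof. by move=> Fc i; rewrite coef_poly; case: ltnP => [/Fc//|_]; exact: subfield0. Qed.

Lemma poly_over_horner p x : poly_over F p -> F x -> F p.[x].
Proof.
move=> Fp Fx; rewrite horner_coef; apply: subfield_sum => i _.
by apply: subfieldM => //; apply: subfieldX.
Qed.

End Closure.

Lemma poly_over_sub F G p : F `<=` G -> poly_over F p -> poly_over G p.
Proof. by move=> FG Fp k; apply/FG. Qed.

Lemma algebraic_over_sub F G x : F `<=` G -> algebraic_over F x -> algebraic_over G x.
Proof. by move=> FG [p [p0 /(poly_over_sub FG) Gp px]]; exists p. Qed.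

Lemma smallest_is_subfield (S : set L) : is_subfield (smallest (@is_subfield L) S).
Proof.
split=> [|x y /set_mem Sx /set_mem Sy|x y /set_mem Sx /set_mem Sy];
  apply/mem_set => F [hF SF].
- exact: subfield1.
- by apply: subfieldB => //; [apply: Sx|apply: Sy].
- by apply: subfieldDiv => //; [apply: Sx|apply: Sy].
Qed.

Lemma adjoin_is_subfield (K S : set L) : is_subfield (adjoin K S).
Proof. exact: smallest_is_subfield. Qed.

Lemma sub_adjoinl (K S : set L) : K `<=` adjoin K S.
Proof. by apply: sub_smallest => x; left. Qed.

Lemma sub_adjoinr (K S : set L) : S `<=` adjoin K S.
Proof. by apply: sub_smallest => x; right. Qed.

Lemma adjoin_sub (K S F : set L) :
  is_subfield F -> K `<=` F -> S `<=` F -> adjoin K S `<=` F.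
Proof. by move=> hF KF SF; apply: smallest_sub => // x [/KF|/SF]. Qed.

Lemma adjoinS (K K' S S' : set L) : K `<=` adjoin K' S' -> S `<=` adjoin K' S' ->
  adjoin K S `<=` adjoin K' S'.
Proof. by apply: adjoin_sub; apply: adjoin_is_subfield. Qed.

Lemma adjoin_adjoin (K S T : set L) : adjoin (adjoin K S) T = adjoin K (S `|` T).
Proof.
apply/seteqP; split; apply: adjoinS.
- apply: adjoinS; first exact: sub_adjoinl.
  by apply: subset_trans (@sub_adjoinr _ _); left.
- by apply: subset_trans (@sub_adjoinr _ _); right.
- exact: subset_trans (@sub_adjoinl _ _) (@sub_adjoinl _ _).
- rewrite subUset; split; last exact: sub_adjoinr.
  exact: subset_trans (@sub_adjoinr _ _) (@sub_adjoinl _ _).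
Qed.

End Subfields.

(** * Simple extensions: fractions, exchange, transitivity *)

Section SimpleExtensions.
Variable L : fieldType.
Implicit Types F : set L.

Lemma adjoin1_frac F w x : is_subfield F -> adjoin F [set w] x ->
  exists p q, [/\ poly_over F p, poly_over F q, q.[w] != 0 & x = p.[w] / q.[w]].
Proof.
move=> hF; have F1 : poly_over F 1 by rewrite -polyC1; apply: poly_overC => //; apply: subfield1.
apply: (@adjoin_sub _ F [set w] [set x | exists p q,
  [/\ poly_over F p, poly_over F q, q.[w] != 0 & x = p.[w] / q.[w]]]); last 2 first.
- move=> c Fc; exists c%:P, 1; split=> //; first exact: poly_overC.
  + by rewrite hornerC oner_eq0.
  + by rewrite !hornerC divr1.
- move=> _ ->; exists 'X, 1; split=> //; first exact: poly_overX.
  + by rewrite hornerC oner_eq0.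
  + by rewrite hornerX hornerC divr1.
split; [apply/mem_set; exists 1, 1; split=> //| |].
- by rewrite hornerC oner_eq0.
- by rewrite !hornerC divr1.
- move=> _ _ /set_mem[p [q [Fp Fq q0 ->]]] /set_mem[p' [q' [Fp' Fq' q'0 ->]]].
  apply/mem_set; exists (p * q' - p' * q), (q * q'); split.
  + by apply: poly_overB => //; apply: poly_overM.
  + exact: poly_overM.
  + by rewrite hornerM mulf_neq0.
  + by rewrite hornerD hornerN !hornerM -mulNr addf_div// mulNr.
- move=> _ _ /set_mem[p [q [Fp Fq q0 ->]]] /set_mem[p' [q' [Fp' Fq' q'0 ->]]].
  apply/mem_set; have [p'0|p'0] := eqVneq p'.[w] 0.
    exists 0, 1; split=> //; first by rewrite -polyC0; apply: poly_overC => //; apply: subfield0.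
      by rewrite hornerC oner_eq0.
    by rewrite p'0 mul0r invr0 mulr0 horner0 mul0r.
  exists (p * q'), (q * p'); split; try exact: poly_overM.
    by rewrite hornerM mulf_neq0.
  by rewrite invf_div mulf_div !hornerM.
Qed.

Lemma adjoin1_common_denominator F w (I : finType) (c : I -> L) : is_subfield F ->
  (forall i, adjoin F [set w] (c i)) ->
  exists q (p : I -> {poly L}), [/\ q.[w] != 0, forall i, poly_over F (p i) &
    forall i, c i * q.[w] = (p i).[w]].
Proof.
move=> hF hc.
have /choice[p /choice[q pq]] : forall i, exists p q,
    [/\ poly_over F p, poly_over F q, q.[w] != 0 & c i = p.[w] / q.[w]].
  by move=> i; apply: adjoin1_frac.
exists (\prod_i q i), (fun i => p i * \prod_(j | j != i) q j); split.
- rewrite horner_prod; apply/prodf_neq0 => i _; by case: (pq i).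
- move=> i; apply: poly_overM => //; first by case: (pq i).
  by apply: poly_over_prod => // j _; case: (pq j).
- move=> i; rewrite (bigD1 i)//= !hornerM mulrA; congr (_ * _).
  by case: (pq i) => _ _ q0 ->; rewrite divfK.
Qed.

(** Clearing denominators turns an equation of [v] over $F(w)$ into a polynomial relation over $F$
    between [v] and [w], which is then read as an equation of [w] over $F(v)$. *)
Lemma algebraic_over_exchange F v w : is_subfield F ->
  ~ algebraic_over F v -> algebraic_over (adjoin F [set w]) v ->
  algebraic_over (adjoin F [set v]) w.
Proof.
move=> hF vF [f [f0 Ff /rootP fv]].
have [q [p [q0 Fp pq]]] : exists q (p : nat -> {poly L}),
    [/\ q.[w] != 0, forall i, poly_over F (p i) & forall i, f`_i * q.[w] = (p i).[w]].
  have [|q [p [q0 Fp pq]]] :=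
    @adjoin1_common_denominator F w 'I_(size f) (fun i => f`_i) hF _.
    by move=> i; apply: Ff.
  exists q, (fun i => oapp p 0 (insub i)); split=> // i.
    by case: insubP => //= _ k; rewrite coef0; apply: subfield0.
  case: insubP => [u _ <-|nlt_i] /=; first exact: pq.
  rewrite horner0 nth_default ?mul0r//.
  by rewrite leqNgt.
(* [h] takes at [w] the value $q(w) f(v) = 0$, and its coefficients are the [(g k).[v]]. If [h] were
   zero, transcendence of [v] would kill every [g k], hence every [p i], hence the leading
   coefficient of [f]. *)
pose g k := \poly_(i < size f) (p i)`_k.
pose h := \sum_(i < size f) v ^+ i *: p i.
have hk k : h`_k = (g k).[v].
  rewrite coef_sum horner_poly; apply: eq_bigr => i _.
  by rewrite coefZ mulrC.
exists h; split.
- apply/eqP => h0; apply: vF; apply: contrapT => vF.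
  have p0 i : (i < size f)%N -> p i = 0.
    move=> lti; apply/polyP => k; rewrite coef0.
    have gk0 : g k = 0.
      apply/eqP/negP => /negP gk0; apply: vF; exists (g k); split=> //.
        by apply: poly_over_poly => // j _; apply: Fp.
      by rewrite rootE -hk h0 coef0.
    by have := congr1 (fun r : {poly L} => r`_i) gk0; rewrite coef0 coef_poly lti.
  have lt_f : ((size f).-1 < size f)%N by rewrite prednK// size_poly_gt0.
  move: (f0); rewrite -lead_coef_eq0 lead_coefE; apply/negP; rewrite negbK.
  have /eqP := pq (size f).-1.
  by rewrite p0// horner0 mulf_eq0 (negPf q0) orbF.
- move=> k; rewrite coef_sum; apply: (subfield_sum (@adjoin_is_subfield _ _ _)) => i _.
  rewrite coefZ; apply: (subfieldM (@adjoin_is_subfield _ _ _)).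
    by apply: (subfieldX (@adjoin_is_subfield _ _ _)); apply: sub_adjoinr.
  by apply: sub_adjoinl; apply: Fp.
- rewrite rootE horner_sum (eq_bigr (fun i : 'I_(size f) => f`_i * v ^+ i * q.[w])).
    by rewrite -mulr_suml -horner_coef fv mul0r.
  by move=> i _; rewrite hornerZ -pq mulrA [v ^+ _ * _]mulrC.
Qed.

(** The elements algebraic over $F$ form a field containing $F$ and [w], so the equation of [x] has
    coefficients integral over $F$. *)
Lemma algebraic_over_trans F w x : is_subfield F ->
  algebraic_over F w -> algebraic_over (adjoin F [set w]) x -> algebraic_over F x.
Proof.
move=> /subfield_embedding[E [f <-]] /algebraic_over_range Fw [p [p0 Fp px]].
apply/algebraic_over_range/integral_algebraic.
apply: (integral_root p0 px) => c /(nthP 0)[i _ <-]; apply/integral_algebraic.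
apply: (@adjoin_sub _ (range f) [set w] [set c | algebraicOver f c] _ _ _ _ (Fp i)).
- split; first exact/mem_set/algebraic1.
  + by move=> y z /set_mem fy /set_mem fz; apply/mem_set/algebraic_sub.
  + by move=> y z /set_mem fy /set_mem fz; apply/mem_set/algebraic_div.
- by move=> _ [c' _ <-]; apply: algebraic_id.
- by move=> _ ->.
Qed.

End SimpleExtensions.

(** * Minimal polynomials and separable elements *)

Section Separability.
Variable L : fieldType.
Implicit Types (F : set L) (x : L).

Lemma separable_over_mem F x : is_subfield F -> F x -> separable_over F x.
Proof.
move=> hF Fx; exists ('X - x%:P); split; last first.
  by rewrite separable_poly.unlock derivXsubC coprimep1.
split; [exact: monicXsubC| |by rewrite root_XsubC|].
  by apply: poly_overB => //; [exact: poly_overX|exact: poly_overC].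
by move=> q q0 _ qx; rewrite size_XsubC; apply: root_size_gt1 qx.
Qed.

Lemma exists_minpoly F x : is_subfield F -> algebraic_over F x ->
  exists p, is_minpoly F x p.
Proof.
move=> hF [r [r0 Fr rx]].
pose P n := `[< exists p, [/\ p != 0, poly_over F p, root p x & size p = n] >].
have exP : exists n, P n by exists (size r); apply/asboolP; exists r.
case: (ex_minnP exP) => n /asboolP[p [p0 Fp px pn]] n_min.
exists ((lead_coef p)^-1 *: p); split.
- by rewrite monicE lead_coefZ mulVf// lead_coef_eq0.
- by move=> k; rewrite coefZ; apply: subfieldM => //; apply: subfieldV => //; apply: Fp.
- by rewrite rootZ// invr_eq0 lead_coef_eq0.
- move=> q q0 Fq qx; rewrite size_scale ?invr_eq0 ?lead_coef_eq0// pn.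
  by apply: n_min; apply/asboolP; exists q.
Qed.

(** Write the minimal polynomial as $p = e d$ with $d = \gcd(p, p')$. As $p' \neq 0$ has smaller
    degree than $p$, minimality excludes $d(x) = 0$; so $e(x) = 0$, and minimality forces $d$ to be
    constant. *)
Lemma separable_over_char0 F x : is_subfield F -> [pchar L] =i pred0 ->
  algebraic_over F x -> separable_over F x.
Proof.
move=> hF charL /(exists_minpoly hF)[p min_p]; exists p; split=> //.
case: min_p => p_monic + px; have [E [f <-]] := subfield_embedding hF.
move=> /poly_over_range[q pq] p_min.
have p0 : p != 0 by exact: monic_neq0.
have q0 : q != 0 by apply: contra_neq p0 => q0; rewrite pq q0 rmorph0.
have p_gt1 : (1 < size p)%N := root_size_gt1 p0 px.
have dp0 : p^`() != 0.
  apply/eqP => /polyP/(_ (size p).-2); rewrite coef_deriv coef0 => /eqP.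
  rewrite prednK ?ltn_predRL// -mulr_natr mulf_eq0 -lead_coefE lead_coef_eq0 (negPf p0)/=.
  by rewrite ((pcharf0P L).1 charL) => /eqP sp; move: p_gt1; rewrite -subn_gt0 subn1 sp.
have /dvdpP[e qe] := dvdp_gcdl q q^`(); set d := gcdp _ _ in qe.
have size_d : size (map_poly f d) = size (gcdp p p^`()).
  by rewrite gcdp_map -deriv_map -pq.
rewrite separable_poly.unlock /coprimep -size_d.
have [e0 d0] : e != 0 /\ d != 0 by apply/andP; rewrite -negb_or -mulf_eq0 -qe.
have d_gt0 : (0 < size (map_poly f d))%N by rewrite size_poly_gt0 map_poly_eq0.
have pE : p = map_poly f e * map_poly f d by rewrite pq {1}qe rmorphM.
move: px; rewrite {1}pE rootM => /orP[ex|dx].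
  have := p_min _ _ (poly_over_map f e) ex; rewrite map_poly_eq0 => /(_ e0).
  rewrite pE size_mul ?map_poly_eq0//.
  move: d_gt0; case: (size (map_poly f d)) => // -[//|m] _.
  by rewrite !addnS /= -ltn_subRL subnn.
have := p_min _ _ (poly_over_map f d) dx; rewrite map_poly_eq0 => /(_ d0).
rewrite size_d => /leq_trans/(_ (dvdp_leq dp0 (dvdp_gcdr _ _))).
by rewrite leqNgt lt_size_deriv.
Qed.

End Separability.

(** * Characteristic p: purely inseparable elements and MacLane's criterion *)

Section PthPowers.
Variables (L : fieldType) (p : nat) (pcharL : p \in [pchar L]).
Implicit Types (F K : set L) (x : L).

Let p_gt0 : (0 < p)%N. Proof. exact/prime_gt0/(pcharf_prime pcharL). Qed.

(** The gcd of [f] and $X^p - x^p = (X - x)^p$ has coefficients in $F$ and is $(X - x)^k$ up to a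
    scalar. A nonzero [f] would give $0 < k < p$, and a coefficient of this power then yields $x \in
    F$. *)
Lemma purely_inseparable_degree F x (f : {poly L}) : is_subfield F ->
  F (x ^+ p) -> ~ F x -> poly_over F f -> (size f <= p)%N -> f.[x] = 0 -> f = 0.
Proof.
move=> hF Fxp nFx Ff size_f /rootP fx; apply/eqP/negP => /negP f0; apply: nFx.
have [E [iota FE]] := subfield_embedding hF.
rewrite -FE in Ff Fxp; have [g fg] := poly_over_range Ff; have [c _ cx] := Fxp.
have hX : map_poly iota ('X^p - c%:P) = ('X - x%:P) ^+ p.
  rewrite rmorphB/= map_polyXn map_polyC/= cx.
  have pcharP : p \in [pchar {poly L}] by rewrite pchar_poly.
  by rewrite -!(pFrobenius_autE pcharP) rmorphB/= !pFrobenius_autE rmorphXn.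
set d := gcdp f (('X - x%:P) ^+ p).
have Fd : poly_over F d.
  by rewrite /d -FE -hX fg -gcdp_map; apply: poly_over_map.
have d0 : d != 0 by rewrite gcdp_eq0 negb_and f0.
have dx : root d x.
  by rewrite root_gcd fx rootE horner_exp !hornerE subrr expf_eq0 p_gt0 eqxx.
have size_d : (size d <= p)%N by rewrite (leq_trans _ size_f)// dvdp_leq ?dvdp_gcdl.
have /dvdp_exp_XsubCP[k _ dk] := dvdp_gcdr f (('X - x%:P) ^+ p).
have sd : size d = k.+1 by rewrite (eqp_size dk) size_exp_XsubC.
have k_gt0 : (0 < k)%N by rewrite -ltnS -sd (root_size_gt1 d0 dx).
have Fk : poly_over F (('X - x%:P) ^+ k).
  suff <- : (lead_coef d)^-1 *: d = ('X - x%:P) ^+ k.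
    move=> i; rewrite coefZ; apply: subfieldM => //.
    by apply: subfieldV => //; rewrite lead_coefE; apply: Fd.
  apply/eqP; rewrite -eqp_monic ?monic_exp ?monicXsubC//.
    by rewrite (eqp_ltrans (eqp_scale _ _)) ?invr_eq0 ?lead_coef_eq0.
  by rewrite monicE lead_coefZ mulVf// lead_coef_eq0.
have k0 : k%:R != 0 :> L.
  by rewrite -(dvdn_pcharf pcharL) gtnNdvd// -sd.
(* The coefficient of $X^{k-1}$ in $(X - x)^k$ is $-kx$, and $k$ is invertible. *)
have := Fk k.-1.
have -> : ('X - x%:P) ^+ k = \prod_(z <- nseq k x) ('X - z%:P).
  by rewrite big_nseq -Monoid.iteropE.
rewrite -[k in k.-1](size_nseq k x) coefPn_prod_XsubC ?size_nseq -?lt0n//.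
rewrite big_nseq iter_addr addr0 => /(subfieldN hF); rewrite opprK -mulr_natr => Fxk.
rewrite -(mulfK k0 x); apply: subfieldDiv => //.
by apply: subfieldMn => //; apply: subfield1.
Qed.

(** A variant of [lin_indep] over any finite index type, since products of index sets occur
    below. *)
Definition fam_indep F (I : finType) (y : I -> L) : Prop :=
  forall c : I -> L, (forall i, F (c i)) -> \sum_i c i * y i = 0 ->
    forall i, c i = 0.

(* MacLane's criterion for the separability of [L/F]. *)
Definition frob_separable F : Prop :=
  forall (I : finType) (y : I -> L),
    fam_indep F y -> fam_indep F (fun i => y i ^+ p).

Lemma frob_sum (I : finType) (y : I -> L) : (\sum_i y i) ^+ p = \sum_i y i ^+ p.
Proof. by rewrite -(pFrobenius_autE pcharL) rmorph_sum. Qed.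

(* A family of [K] spanning its [K^p]-span is replaced by a [K^p]-basis of that
   span; this is the symmetry of linear disjointness. *)
Lemma separable_extension_frob K : is_subfield K -> separable_extension K ->
  frob_separable K.
Proof.
move=> hK /(_ p pcharL) K_disj I y y_indep c Kc c0.
pose indep (A : {set I}) := forall d : I -> L, (forall i, K (d i)) ->
  \sum_(i in A) d i ^+ p * c i = 0 -> forall i, i \in A -> d i = 0.
have /ex_maxset[A /maxsetP[/asboolP A_indep A_max]] :
    exists A : {set I}, `[< indep A >].
  by exists finset.set0; apply/asboolP => d _ _ i; rewrite inE.
have c_span i : exists d : I -> L, (forall j, K (d j)) /\
    c i = \sum_(j in A) d j ^+ p * c j.
  have [iA|niA] := boolP (i \in A).
    exists (fun j => (j == i)%:R); split.
      by move=> j; case: eqP => _; [exact: subfield1|exact: subfield0].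
    rewrite (bigD1 i)//= eqxx expr1n mul1r big1 ?addr0// => j /andP[_ /negPf->].
    by rewrite expr0n gtn_eqF// mul0r.
  have : ~ indep (i |: A)%SET.
    move=> /asboolP /A_max /(_ (finset.subsetUr _ _)) iA.
    by move: niA; rewrite -iA finset.setU11.
  move=> /existsNP[d /not_implyP[Kd /not_implyP[ds /existsNP[k /not_implyP[kiA dk]]]]].
  rewrite finset.big_setU1//= in ds.
  have di : d i != 0.
    apply/eqP => di; rewrite di expr0n gtn_eqF// mul0r add0r in ds.
    apply: dk; move: kiA; rewrite finset.in_setU1 => /orP[/eqP->//|kA].
    exact: (A_indep d).
  exists (fun j => - (d j / d i)); split.
    by move=> j; apply: subfieldN => //; apply: subfieldDiv.
  apply: (mulfI (expf_neq0 p di)); move/eqP: ds; rewrite addr_eq0 => /eqP->.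
  rewrite mulr_sumr -sumrN; apply: eq_bigr => j _.
  rewrite mulrA -exprMn mulrN mulrCA divff// mulr1.
  by rewrite -!(pFrobenius_autE pcharL) pFrobenius_autN mulNr.
have [d /all_and2[Kd cE]] := choice c_span.
(* Substituting the expansions of the [c i] gives $\sum_{j \in A} (\sum_i d_{ij} y_i)^p c_j = 0$.
   The $c_j$ with $j \in A$ are independent over $K^p$, hence over $L^p$ by linear disjointness, so
   every inner sum vanishes. *)
have dy j : j \in A -> \sum_i d i j * y i = 0.
  move=> jA; pose s u := \sum_i d i u * y i.
  have s0 : forall u : 'I_#|A|, s (enum_val u) ^+ p = 0.
    apply: (K_disj #|A| (fun u => c (enum_val u))) => [u|b|u|]; first exact: Kc.
    - move=> /(_ _)/cid2; move=> hb; pose b' v := s2val (hb v).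
      have Kb' v : K (b' v) := s2valP (hb v).
      have bE v : b v = b' v ^+ p := esym (s2valP' (hb v)).
      move=> bs u; have b1E v : b' (enum_rank_in jA (enum_val v)) = b' v.
        by rewrite enum_valK_in.
      have /= := A_indep (b' \o enum_rank_in jA) _ _ _ (enum_valP u).
      rewrite bE b1E => ->//; first by rewrite expr0n gtn_eqF.
      by rewrite big_enum_val -[RHS]bs; apply: eq_bigr => v _; rewrite b1E bE.
    - by exists (s (enum_val u)).
    - rewrite -(big_enum_val (fun u => s u ^+ p * c u)) -[RHS]c0.
      rewrite [RHS](eq_bigr (fun i => \sum_(j in A) (d i j * y i) ^+ p * c j)).
        by rewrite exchange_big; apply: eq_bigr => u _; rewrite frob_sum mulr_suml.
      move=> i _; rewrite [c i in LHS]cE mulr_suml; apply: eq_bigr => u _.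
      by rewrite exprMn mulrAC.
  have /eqP := s0 (enum_rank_in jA j).
  by rewrite enum_rankK_in// expf_eq0 p_gt0 => /eqP.
move=> i; rewrite cE big1// => j jA.
by rewrite (y_indep (d^~ j) _ (dy j jA)) ?expr0n ?gtn_eqF ?mul0r.
Qed.

End PthPowers.

(** * Adjoining an element outside a field that contains K and all p-th powers *)

Section TranscendentalStep.
Variables (L : fieldType) (p : nat) (pcharL : p \in [pchar L]).
Implicit Types (F K : set L) (x : L).

Let p_gt0 : (0 < p)%N. Proof. exact/prime_gt0/(pcharf_prime pcharL). Qed.
Let p_gt1 : (1 < p)%N. Proof. exact/prime_gt1/(pcharf_prime pcharL). Qed.

Lemma sum_blocks (N : nat) (G : nat -> L) :
  \sum_(i < N * p) G i = \sum_(k < N) \sum_(b < p) G (k * p + b)%N.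
Proof.
rewrite -(big_mkord predT) big_nat_mul big_mkord; apply: eq_bigr => k _.
rewrite -{1}[(k * p)%N]add0n mulSn big_addn addnK big_mkord.
by apply: eq_bigr => b _; rewrite addnC.
Qed.

Variables (K F : set L) (x : L).
Hypotheses (hF : is_subfield F) (KF : K `<=` F) (FX : forall y, F (y ^+ p)).
Hypothesis nFx : ~ F x.

(* [f = \sum_(b < p) 'X^b * g_b('X^p)], and [x] has degree [p] over [F]. *)
Lemma blocks_eq0 (I : finType) (f : I -> {poly L}) (y : I -> L) (N : nat) :
  (forall i, poly_over K (f i)) -> (forall i, (size (f i) <= N * p)%N) ->
  \sum_i (f i).[x] * y i ^+ p = 0 ->
  forall b, (b < p)%N ->
    \sum_i \sum_(k < N) (f i)`_(k * p + b) * (x ^+ k * y i) ^+ p = 0.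
Proof.
move=> Kf size_f f0 b lt_b.
(* Grouping exponents by their residue mod $p$ turns the relation into $g(x) = 0$, with [g] over $F$
   because $F$ contains $K$ and all p-th powers. *)
pose g := \poly_(b < p) \sum_i \sum_(k < N) (f i)`_(k * p + b) * (x ^+ k * y i) ^+ p.
suff /polyP/(_ b) : g = 0 by rewrite coef0 coef_poly lt_b.
apply: (purely_inseparable_degree pcharL hF (FX x) nFx); last 1 first.
- rewrite horner_poly -[RHS]f0.
  under eq_bigr do rewrite mulr_suml; rewrite exchange_big; apply: eq_bigr => i _ /=.
  under eq_bigr do rewrite mulr_suml; rewrite exchange_big /=.
  rewrite (horner_coef_wide _ (size_f i)) mulr_suml.
  rewrite (sum_blocks N (fun j => (f i)`_j * x ^+ j * y i ^+ p)).
  apply: eq_bigr => k _; apply: eq_bigr => c _.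
  by rewrite exprMn exprD -exprM -!mulrA; congr (_ * (_ * _)); rewrite mulrC.
- apply: poly_over_poly => // c _; apply: subfield_sum => // i _.
  by apply: subfield_sum => // k _; apply: subfieldM => //; apply/KF/Kf.
- exact: size_poly.
Qed.

Hypotheses (hK : is_subfield K) (K_sep : frob_separable p K).

(** Induction on the size: no shorter relation exists, so the lower powers of [x] are independent
    over $K$. By the criterion so are their p-th powers, and each residue class of coefficients of
    [f] gives a relation among these. *)
Lemma frob_separable_transcendental (f : {poly L}) :
  poly_over K f -> f.[x] = 0 -> f = 0.
Proof.
move: {2}(size f) (leqnn (size f)) => N; elim: N f => [|N IHN] f.
  by rewrite leqn0 size_poly_eq0 => /eqP.
case: N IHN => [|M] IHN size_f Kf fx.
  by move: fx; rewrite (size1_polyC size_f) hornerC => ->.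
have indep : fam_indep K (fun k : 'I_M.+1 => x ^+ k).
  move=> c Kc c0 k; pose g := \poly_(i < M.+1) c (inord i).
  suff /polyP/(_ k) : g = 0 by rewrite coef0 coef_poly ltn_ord inord_val.
  apply: IHN; first exact: size_poly.
    by apply: poly_over_poly.
  by rewrite horner_poly -[RHS]c0; apply: eq_bigr => i _; rewrite inord_val.
(* Because $M + 2 \le (M + 1) p$, the blocks of [f] involve only the powers $x^k$ with $k \le M$,
   which [indep] covers. *)
have size_fp : (size f <= M.+1 * p)%N.
  rewrite (leq_trans size_f)// -[M.+2]addn1.
  by rewrite (leq_trans _ (leq_mul (leqnn M.+1) p_gt1))// muln2 -addnn leq_add2l.
have f0 := @blocks_eq0 unit (fun=> f) (fun=> 1) M.+1 (fun=> Kf) (fun=> size_fp) _.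
apply/polyP => i; rewrite coef0.
have [lt_i|] := ltnP i (M.+1 * p); last first.
  by move=> le_i; rewrite nth_default// (leq_trans size_fp).
have lt_d : (i %/ p < M.+1)%N by rewrite ltn_divLR.
rewrite (divn_eq i p).
apply: (K_sep indep (c := fun k : 'I_M.+1 => f`_(k * p + i %% p)%N) _ _ (Ordinal lt_d)) => //.
rewrite -[RHS](f0 _ (i %% p)%N (ltn_pmod _ p_gt0)).
  by rewrite big_const card_unit /= addr0; apply: eq_bigr => k _; rewrite mulr1.
by rewrite big_const card_unit /= addr0 fx mul0r.
Qed.

Lemma frob_separable_not_algebraic : ~ algebraic_over K x.
Proof.
move=> [f [f0 Kf /rootP fx]].
by move: f0; rewrite (frob_separable_transcendental Kf fx) eqxx.
Qed.

(** After clearing denominators the coefficients are values at [x] of polynomials over $K$. The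
    products $x^k y_j$ are independent over $K$, so the criterion for $K$ applies to them and kills
    these polynomials block by block. *)
Lemma frob_separable_adjoin1 : frob_separable p (adjoin K [set x]).
Proof.
move=> I y y_indep c Kc c0 i.
have [q [f [q0 Kf fE]]] := adjoin1_common_denominator hK Kc.
pose N := \sum_i size (f i).
have size_f j : (size (f j) <= N * p)%N.
  by rewrite (leq_trans _ (leq_pmulr _ p_gt0))// /N (bigD1 j)//= leq_addr.
have indep : fam_indep K (fun jk : I * 'I_N => x ^+ jk.2 * y jk.1).
  move=> d Kd ds [j k].
  (* Collecting the powers of [x] makes the relation $\sum_j g_j(x) y_j = 0$ over $K(x)$; then
     $g_j(x) = 0$, and $g_j = 0$ by transcendence of [x]. *)
  pose g j := \poly_(k < N) oapp (fun k => d (j, k)) 0 (insub k).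
  have gx j' : (g j').[x] = \sum_(k < N) d (j', k) * x ^+ k.
    by rewrite horner_poly; apply: eq_bigr => k' _; rewrite valK.
  have Kg j' : poly_over K (g j').
    apply: poly_over_poly => // k' _; case: insubP => [u _ _|_] /=; first exact: Kd.
    exact: subfield0.
  suff /polyP/(_ k) : g j = 0 by rewrite coef0 coef_poly ltn_ord valK.
  apply: frob_separable_transcendental => //.
  apply: (y_indep (fun j => (g j).[x])) => [j'|].
    apply: (poly_over_horner (@adjoin_is_subfield _ K [set x])).
      exact: poly_over_sub (@sub_adjoinl _ _ _) (Kg j').
    by apply: sub_adjoinr.
  rewrite -[RHS]ds (eq_bigr (P := predT) (r := index_enum (I * 'I_N)%type)
    (fun jk => d (jk.1, jk.2) * (x ^+ jk.2 * y jk.1))); last by case.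
  rewrite -(pair_bigA _ (fun j (k : 'I_N) => d (j, k) * (x ^+ k * y j)))/=.
  apply: eq_bigr => j' _; rewrite gx mulr_suml.
  by apply: eq_bigr => k' _; rewrite mulrA.
suff fi0 : f i = 0.
  by have /eqP := fE i; rewrite fi0 horner0 mulf_eq0 (negPf q0) orbF => /eqP.
apply/polyP => m; rewrite coef0.
have [lt_m|] := ltnP m (N * p); last first.
  by move=> le_m; rewrite nth_default// (leq_trans (size_f i)).
have lt_d : (m %/ p < N)%N by rewrite ltn_divLR.
rewrite (divn_eq m p).
apply: (K_sep indep (c := fun jk => (f jk.1)`_(jk.2 * p + m %% p)%N) _ _
  (i, Ordinal lt_d)) => [jk|].
  exact: Kf.
rewrite -(pair_bigA _ (fun j (k : 'I_N) => (f j)`_(k * p + m %% p)%N * (x ^+ k * y j) ^+ p))/=.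
apply: blocks_eq0 => //; last exact: ltn_pmod.
rewrite -[RHS](mulr0 q.[x]) -[X in _ * X]c0 mulr_sumr; apply: eq_bigr => j _.
by rewrite -fE mulrA [q.[x] * _]mulrC.
Qed.

End TranscendentalStep.

(** * Families adjoined one element at a time: p-independence and exchange *)

Section IndexedFamilies.
Variables (L : fieldType) (T : Type) (idx : T -> nat) (u : T -> L) (V : set T).
Hypothesis idx_inj : injective idx.
Implicit Types (F K : set L) (q r : T).

Definition initial (t : nat) : set L := u @` [set r | V r /\ (idx r < t)%N].

Lemma initialS s t : (s <= t)%N -> initial s `<=` initial t.
Proof.
move=> st _ [r [Vr rs] <-]; exists r => //; split=> //.
exact: leq_trans rs st.
Qed.

Lemma initial0 : initial 0 = set0.
Proof. by apply/seteqP; split=> // x [r []]. Qed.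

Lemma initial_idxS q : V q -> initial (idx q).+1 = initial (idx q) `|` [set u q].
Proof.
move=> Vq; apply/seteqP; split=> [_ [r [Vr]] + <-|_ [[r [Vr lt_r] <-]|->]].
- rewrite ltnS leq_eqVlt => /orP[/eqP/idx_inj->|lt_r]; first by right.
  by left; exists r.
- by exists r => //; split=> //; apply: leqW.
- by exists q.
Qed.

Lemma initialS_eq t : ~ (exists2 q, V q & idx q = t) -> initial t.+1 = initial t.
Proof.
move=> nVt; apply/seteqP; split; last exact: (initialS (leqnSn t)).
move=> _ [r [Vr]] + <-; rewrite ltnS leq_eqVlt => /orP[/eqP rt|lt_r].
  by case: nVt; exists r.
by exists r.
Qed.

Lemma adjoin_set0 F : is_subfield F -> adjoin F set0 = F.
Proof.
move=> hF; apply/seteqP; split; last exact: sub_adjoinl.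
exact: adjoin_sub.
Qed.

Lemma adjoin_initialS F q : V q ->
  adjoin F (initial (idx q).+1) = adjoin (adjoin F (initial (idx q))) [set u q].
Proof. by move=> Vq; rewrite adjoin_adjoin initial_idxS. Qed.

Section PIndependence.
Variables (p : nat) (pcharL : p \in [pchar L]) (K : set L).
Hypotheses (hK : is_subfield K) (K_sep : frob_separable p K).
Let powers : set L := range (fun y : L => y ^+ p).
Hypothesis p_indep : forall q, V q ->
  ~ adjoin K (powers `|` initial (idx q)) (u q).

Let pow_sub t : adjoin K (initial t) `<=` adjoin K (powers `|` initial t).
Proof.
apply: adjoinS; first exact: sub_adjoinl.
by apply: subset_trans (@sub_adjoinr _ _ _); right.
Qed.

Let pow_mem t y : adjoin K (powers `|` initial t) (y ^+ p).
Proof. by apply: sub_adjoinr; left; exists y. Qed.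

(** Each new member lies outside the field generated by $K$, all p-th powers and the earlier
    members, so adjoining it preserves the criterion. *)
Lemma frob_separable_initial t : frob_separable p (adjoin K (initial t)).
Proof.
elim: t => [|t IHt]; first by rewrite initial0 adjoin_set0.
have [[q Vq qt]|/initialS_eq->//] := pselect (exists2 q, V q & idx q = t).
rewrite -qt adjoin_initialS// in IHt *.
apply: (frob_separable_adjoin1 pcharL (adjoin_is_subfield _ _) (@pow_sub _)
  (@pow_mem _) (p_indep Vq)) => //.
exact: adjoin_is_subfield.
Qed.

Lemma p_independent_not_algebraic q : V q ->
  ~ algebraic_over (adjoin K (initial (idx q))) (u q).
Proof.
move=> Vq.
apply: (frob_separable_not_algebraic pcharL (adjoin_is_subfield _ _) (@pow_sub _)
  (@pow_mem _) (p_indep Vq)).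
- exact: adjoin_is_subfield.
- exact: frob_separable_initial.
Qed.

End PIndependence.

(** Allowing exceptions of small index makes the property survive the adjunction of one element to
    $F$. *)
Definition eventually_independent F : Prop := exists B : nat, forall q,
  V q -> (B <= idx q)%N -> ~ algebraic_over (adjoin F (initial (idx q))) (u q).

Lemma eventually_independent_adjoin1 F w : is_subfield F ->
  eventually_independent F -> eventually_independent (adjoin F [set w]).
Proof.
move=> hF [B hB].
have adjC t : adjoin (adjoin F [set w]) (initial t) = adjoin (adjoin F (initial t)) [set w].
  by rewrite !adjoin_adjoin setUC.
have [[q0 [Vq0 Bq0 alg0]]|nbad] := pselect (exists q0, [/\ V q0, (B <= idx q0)%N &
    algebraic_over (adjoin (adjoin F [set w]) (initial (idx q0))) (u q0)]).
  2: by exists B => q Vq Bq alg; apply: nbad; exists q.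
(* If [u q0] has become algebraic, exchange makes [w] algebraic over $F$ and the members up to [q0].
   Beyond [q0], transitivity then eliminates [w], so no further exception can arise. *)
exists (idx q0).+1 => q Vq lt_q; rewrite adjC => alg.
apply: (hB q Vq (leq_trans Bq0 (ltnW lt_q))).
apply: algebraic_over_trans alg; first exact: adjoin_is_subfield.
rewrite adjC in alg0.
have := algebraic_over_exchange (adjoin_is_subfield _ _) (hB q0 Vq0 Bq0) alg0.
rewrite -adjoin_initialS//; apply: algebraic_over_sub.
apply: adjoinS; first exact: sub_adjoinl.
exact: subset_trans (initialS lt_q) (@sub_adjoinr _ _ _).
Qed.

End IndexedFamilies.

(** * Rules for derivations *)

Section Derivations.
Variables (L : fieldType) (delta : L -> L).
Hypothesis hdelta : is_derivation delta.
Implicit Types x y : L.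

Lemma derivationD x y : delta (x + y) = delta x + delta y.
Proof. by case: hdelta. Qed.

Lemma derivationM x y : delta (x * y) = delta x * y + x * delta y.
Proof. by case: hdelta. Qed.

Lemma derivation0 : delta 0 = 0.
Proof. by apply: (addrI (delta 0)); rewrite -derivationD !addr0. Qed.

Lemma derivationB x y : delta (x - y) = delta x - delta y.
Proof. by apply: (addIr (delta y)); rewrite -derivationD !subrK. Qed.

Lemma derivation1 : delta 1 = 0.
Proof. by apply: (addrI (delta 1)); rewrite addr0 -[in RHS](mulr1 1) derivationM mulr1 mul1r. Qed.

Lemma derivation_div x y : delta (x / y) = (delta x - x / y * delta y) / y.
Proof.
have [->|y0] := eqVneq y 0; first by rewrite !invr0 !mulr0 derivation0.
apply: (mulIf y0); rewrite divfK//.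
by apply: (addIr (x / y * delta y)); rewrite subrK -derivationM divfK.
Qed.

Lemma derivationX x n : delta (x ^+ n) = (x ^+ n.-1 * delta x) *+ n.
Proof.
case: n => [|n]; first by rewrite derivation1.
elim: n => [|n IHn]; first by rewrite mul1r.
rewrite exprSr derivationM IHn /= [in RHS]mulrSr; congr (_ + _).
by rewrite mulrnAl mulrAC -exprSr.
Qed.

Lemma derivation_pchar p x : p \in [pchar L] -> delta (x ^+ p) = 0.
Proof. by move=> pcharL; rewrite derivationX mulrn_pchar. Qed.

(** The elements of [G] whose derivative is in [G] form a subfield, so generators suffice. *)
Lemma derivation_adjoin (K S G : set L) : is_subfield G ->
  (forall x, (K `|` S) x -> G x /\ G (delta x)) ->
  forall x, adjoin K S x -> G (delta x).
Proof.
move=> hG hKS x; suff /[apply] : adjoin K S `<=` [set x | G x /\ G (delta x)] by case.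
apply: adjoin_sub => [|y Ky|y Sy];
  [|exact: (hKS y (or_introl Ky))|exact: (hKS y (or_intror Sy))].
split=> [|y z /set_mem[Gy Gdy] /set_mem[Gz Gdz]|y z /set_mem[Gy Gdy] /set_mem[Gz Gdz]];
  apply/mem_set; split.
- exact: subfield1.
- by rewrite derivation1; apply: subfield0.
- exact: subfieldB.
- by rewrite derivationB; apply: subfieldB.
- exact: subfieldDiv.
- rewrite derivation_div; apply: subfieldDiv => //; apply: subfieldB => //.
  by apply: subfieldM => //; apply: subfieldDiv.
Qed.

End Derivations.

Lemma bigcup_is_subfield (L : fieldType) (F : nat -> set L) :
  (forall m, is_subfield (F m)) -> (forall m m', (m <= m')%N -> F m `<=` F m') ->
  is_subfield (\bigcup_m F m).
Proof.
move=> hF Fmono.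
split=> [|x y /set_mem[m _ Fx] /set_mem[m' _ Fy]|x y /set_mem[m _ Fx] /set_mem[m' _ Fy]];
  apply/mem_set.
- by exists 0%N => //; apply: subfield1.
- exists (maxn m m') => //; apply: subfieldB => //.
    exact: Fmono (leq_maxl _ _) _ Fx.
  exact: Fmono (leq_maxr _ _) _ Fy.
- exists (maxn m m') => //; apply: subfieldDiv => //.
    exact: Fmono (leq_maxl _ _) _ Fx.
  exact: Fmono (leq_maxr _ _) _ Fy.
Qed.

(** * Jets, their ordering, and rationality under differentiation *)

Section Jets.
Variables (L : fieldType) (delta : L -> L) (K : set L) (n : nat).
Variable a : 'I_n -> L.
Implicit Types q r : nat *l 'I_n.
Local Notation u := (jet delta a).

(** An order embedding into [nat]: finiteness becomes boundedness, and induction along the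
    lexicographic order becomes induction on numbers. *)
Definition rank q : nat := (q.1 * n + q.2)%N.

Lemma rank_div q : (rank q %/ n)%N = q.1.
Proof.
have n_gt0 : (0 < n)%N by apply: leq_ltn_trans (ltn_ord q.2).
by rewrite /rank divnMDl// divn_small ?addn0.
Qed.

Lemma rank_mod q : (rank q %% n)%N = q.2.
Proof. by rewrite /rank modnMDl modn_small. Qed.

Lemma rank_inj : injective rank.
Proof.
move=> q r qr; case: q r qr (rank_div q) (rank_mod q) => [x i] [y j] -> .
by rewrite rank_div rank_mod/= => -> /val_inj ->.
Qed.

Lemma lt_rank q r : (q < r)%O = (rank q < rank r)%N.
Proof.
rewrite Order.ProdLexiOrder.ltEprodlexi !leEnat /rank.
have [||->] := ltngtP q.1 r.1 => /=.
- move=> lt_qr; apply/esym; rewrite (leq_trans _ (leq_addr _ _))//.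
  by rewrite (leq_trans _ (leq_mul lt_qr (leqnn n)))// mulSnr ltn_add2l.
- move=> lt_rq; apply/esym/negbTE; rewrite -leqNgt (leq_trans _ (leq_addr _ _))//.
  by rewrite ltnW// (leq_trans _ (leq_mul lt_rq (leqnn n)))// mulSnr ltn_add2l.
- by rewrite ltn_add2l.
Qed.

Lemma finite_rank_lt (A : set (nat *l 'I_n)) (B : nat) :
  (forall q, A q -> (rank q < B)%N) -> finite_set A.
Proof.
move=> AB; apply: (@sub_finite_set _ _ (rank @^-1` `I_B)); first exact: AB.
by apply: finite_preimage; [move=> q r _ _; exact: rank_inj|exact: finite_II].
Qed.

Lemma finite_minimal_separable_leaders :
  finite_set [set q | minimal_separable_leader delta K a q].
Proof.
set A := [set q | _].
have A_uniq q r : A q -> A r -> q.2 = r.2 -> q = r.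
  case: q r => [x i] [y j] [sq minq] [sr minr] /= ij; rewrite -ij in sr minr *.
  case: (ltngtP x y) => [lt|lt|-> //].
  - by case: minr; exists x.
  - by case: minq; exists y.
have /choice[g gE] : forall j : 'I_n, exists q0, forall q, A q -> q.2 = j -> q = q0.
  move=> j; have [[q0 [Aq0 qj]]|nA] := pselect (exists q, A q /\ q.2 = j).
    by exists q0 => q Aq qj'; apply: A_uniq => //; rewrite qj'.
  (* An arbitrary value for a component without a minimal-separable leader. *)
  by exists (0%N, j) => q Aq qj; case: nA; exists q.
apply: (@finite_rank_lt _ (\max_j rank (g j)).+1) => q Aq.
by rewrite ltnS (gE _ _ Aq erefl) leq_bigmax.
Qed.

Definition next_jet q : nat *l 'I_n := (q.1.+1, q.2).

Lemma rank_next q : rank (next_jet q) = (n + rank q)%N.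
Proof. by rewrite /rank/= mulSn addnA. Qed.

Lemma jet_next q : u (next_jet q) = delta (u q).
Proof. by []. Qed.

Definition before q : set L := u @` [set r | (r < q)%O].

Hypotheses (hdelta : is_derivation delta) (hK : is_diff_subfield delta K).

(** Differentiating the generators stays inside the new field: $K$ is stable, elements of [C] are
    killed, and a jet before [q] becomes one before [next_jet q]. *)
Lemma jet_next_adjoin (C : set L) q : (forall c, C c -> delta c = 0) ->
  adjoin K (C `|` before q) (u q) ->
  adjoin K (C `|` before (next_jet q)) (u (next_jet q)).
Proof.
move=> dC; rewrite jet_next.
set G := adjoin K (C `|` before (next_jet q)).
have hG : is_subfield G := adjoin_is_subfield _ _.
apply: derivation_adjoin => // x [Kx|[Cx|[r rq <-]]]; split.
- exact: sub_adjoinl.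
- by apply: sub_adjoinl; apply: hK.2.
- by apply: sub_adjoinr; left.
- by rewrite dC//; apply: subfield0.
- apply: sub_adjoinr; right; exists r => //=.
  move: rq; rewrite /= !lt_rank rank_next => /ltnW rq.
  apply: leq_ltn_trans (rq : rank r <= rank q)%N _.
  by rewrite -[ltnLHS]add0n ltn_add2r (leq_ltn_trans _ (ltn_ord q.2)).
- rewrite -jet_next; apply: sub_adjoinr; right; exists (next_jet r) => //.
Qed.

Lemma jet_iter_adjoin (C : set L) q k : (forall c, C c -> delta c = 0) ->
  adjoin K (C `|` before q) (u q) ->
  let q' := (k + q.1, q.2)%N in adjoin K (C `|` before q') (u q').
Proof.
move=> dC; case: q => x i hq /=; elim: k => [//|k IHk].
exact: (jet_next_adjoin (q := (k + x, i)%N)).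
Qed.

Definition rational_jet q : Prop := preceding_field delta K a q (u q).

Lemma rational_jet_leq x y i : (x <= y)%N -> rational_jet (x, i) -> rational_jet (y, i).
Proof.
move=> le_xy; rewrite /rational_jet /preceding_field => hx.
have := @jet_iter_adjoin set0 (x, i) (y - x)%N (fun _ => False_ind _).
by rewrite /= subnK// !set0U => /(_ hx).
Qed.

(** Membership depends only on the component of [q]; by [rational_jet_leq] the jets of such a
    component are rational from some order on. *)
Definition eventually_rational : set (nat *l 'I_n) :=
  [set q | exists x : nat, rational_jet (x, q.2)].

Lemma jet_not_pth_power_rational p q : p \in [pchar L] ->
  diff_adjoin delta K a = [set: L] -> ~ eventually_rational q ->
  ~ adjoin K (range (fun y : L => y ^+ p) `|` before q) (u q).
Proof.
move=> pcharL hL nq hq; apply: nq.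
(* The fields [E m] increase and exhaust $L$, so a given p-th power already occurs in some [C m]. *)
pose E m := adjoin K (u @` [set r | (rank r < m)%N]).
pose C m := (fun y => y ^+ p) @` E m.
have EC m m' : (m <= m')%N -> E m `<=` E m'.
  move=> mm'; apply: adjoinS; first exact: sub_adjoinl.
  apply: subset_trans (@sub_adjoinr _ _ _) => _ [r lt_r <-]; exists r => //.
  exact: leq_trans lt_r mm'.
have E_all y : exists m, E m y.
  have : [set: L] y by [].
  rewrite -hL => /(@adjoin_sub _ _ _ (\bigcup_m E m))[].
  - by apply: bigcup_is_subfield => // m; apply: adjoin_is_subfield.
  - by move=> c Kc; exists 0%N => //; apply: sub_adjoinl.
  - move=> _ [r _ <-]; exists (rank r).+1 => //; apply: sub_adjoinr.
    by exists r => //=.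
  - by move=> m _ Em; exists m.
have [m _ hm] : (\bigcup_m adjoin K (C m `|` before q)) (u q).
  apply: adjoin_sub hq.
  - apply: bigcup_is_subfield => [m|m m' mm']; first exact: adjoin_is_subfield.
    apply: adjoinS; first exact: sub_adjoinl.
    apply: subset_trans (@sub_adjoinr _ _ _); apply: setSU.
    by apply: image_subset; apply: EC.
  - by move=> c Kc; exists 0%N => //; apply: sub_adjoinl.
  - move=> _ [[y _ <-]|[r rq <-]]; last first.
      by exists 0%N => //; apply: sub_adjoinr; right; exists r.
    have [m Em] := E_all y.
    by exists m => //; apply: sub_adjoinr; left; exists y.
(* After [m] derivations the rank has grown by $mn \ge m$, so all jets of rank below [m] precede the
   new one and [C m] lies in its preceding field. *)
exists (m + q.1)%N.
have dC c : C m c -> delta c = 0 by move=> [y _ <-]; apply: derivation_pchar.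
have /= := jet_iter_adjoin (k := m) dC hm; apply: adjoinS; first exact: sub_adjoinl.
rewrite subUset; split; last exact: sub_adjoinr.
move=> _ [y Ey <-]; apply: (subfieldX (@adjoin_is_subfield _ _ _)).
apply: adjoinS Ey; first exact: sub_adjoinl.
apply: subset_trans (@sub_adjoinr _ _ _) => _ [r lt_r <-]; exists r => //=.
rewrite lt_rank (leq_trans lt_r)// /rank/= mulnDl -addnA.
by rewrite (leq_trans _ (leq_addr _ _))// leq_pmulr// (leq_ltn_trans _ (ltn_ord q.2)).
Qed.

Lemma eventually_rational_bound : exists B : nat, forall q,
  eventually_rational q -> (B <= rank q)%N -> rational_jet q.
Proof.
have /choice[g gE] : forall j : 'I_n, exists x,
    (exists y, rational_jet (y, j)) -> rational_jet (x, j).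
  move=> j; have [[y hy]|nex] := pselect (exists y, rational_jet (y, j)).
    by exists y.
  by exists 0%N.
(* The factor [n] converts orders to ranks: rank at least $g_j n$ means order at least $g_j$. *)
exists (\max_j (g j * n))%N => -[x j] /gE hg le_B.
apply: rational_jet_leq hg => /=; rewrite -[leqRHS](rank_div (x, j)).
have n_gt0 : (0 < n)%N by apply: leq_ltn_trans (ltn_ord j).
rewrite leq_divRL// (leq_trans _ le_B)//.
exact: (leq_bigmax (F := fun j => (g j * n)%N)).
Qed.

End Jets.

(** * Bounding the inseparable leaders *)

Section InseparableLeaders.
Variables (L : fieldType) (delta : L -> L) (K : set L) (n : nat).
Variable a : 'I_n -> L.
Hypotheses (hdelta : is_derivation delta) (hK : is_diff_subfield delta K).
Hypothesis hL : diff_adjoin delta K a = [set: L].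
Local Notation u := (jet delta a).
Local Notation W := (eventually_rational delta K a).
Local Notation V := (~` eventually_rational delta K a).
Local Notation before_in := (initial (@rank n) u).

Lemma before_rank q : before delta a q = u @` [set r | (rank r < rank q)%N].
Proof. by congr image; apply/funext => r /=; rewrite lt_rank. Qed.

(** A jet before [q] is in [V], or in [W] with rank below [B], or rational over jets of smaller
    rank; induction on the rank removes the last kind. *)
Lemma preceding_field_sub (B : nat) q :
  (forall r, W r -> (B <= rank r)%N -> rational_jet delta K a r) ->
  preceding_field delta K a q `<=`
    adjoin (adjoin K (before_in W B)) (before_in V (rank q)).
Proof.
move=> hB; set G := adjoin (adjoin K _) _.
have hG : is_subfield G := adjoin_is_subfield _ _.
have KG : K `<=` G by apply: subset_trans (@sub_adjoinl _ _ _); apply: sub_adjoinl.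
suff uG r : (rank r < rank q)%N -> G (u r).
  by apply: adjoin_sub => // _ [r rq <-]; apply: uG; rewrite -lt_rank.
move: {2}(rank r) (leqnn (rank r)) => m; elim: m r => [|m IHm] r le_r lt_r.
all: have [Wr|Vr] := pselect (W r); last by apply: sub_adjoinr; exists r.
all: have [lt_rB|le_Br] := ltnP (rank r) B;
  first by apply: sub_adjoinl; apply: sub_adjoinr; exists r.
all: apply: adjoin_sub (hB r Wr le_Br) => // _ [s + <-]; rewrite /= lt_rank => lt_s.
  by move: (leq_trans lt_s le_r).
apply: IHm; last exact: ltn_trans lt_s lt_r.
by rewrite -ltnS (leq_trans lt_s).
Qed.

(** Beyond the bound a jet in [W] is rational, hence a separable leader, and a jet in [V] is no
    leader at all. *)
Lemma inseparable_leaders_bounded : separable_extension K ->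
  exists B : nat, forall q, inseparable_leader delta K a q -> (rank q < B)%N.
Proof.
move=> K_sep; have hKf := hK.1.
have [[p pcharL]|no_pchar] := pselect (exists p, p \in [pchar L]); last first.
  exists 0%N => q [alg []]; apply: separable_over_char0 alg.
    exact: adjoin_is_subfield.
  by move=> p; apply/negP => pcharL; apply: no_pchar; exists p.
have [B0 hB0] := eventually_rational_bound a hdelta hK.
have [B hB] : eventually_independent (@rank n) u V (adjoin K (before_in W B0)).
  (* Induction on the rank bound adjoins the early jets of [W] singly; the base case over $K$ has no
     exceptions. *)
  elim: B0 {hB0} => [|t IHt].
    rewrite initial0 adjoin_set0//; exists 0%N => q Vq _.
    apply: (p_independent_not_algebraic (@rank_inj n) pcharL hKf) => //.
      exact: separable_extension_frob.
    (* p-independence holds relative to all preceding jets, in particular relative to those in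
       [V]. *)
    move=> r Vr /adjoinS hr.
    apply: (jet_not_pth_power_rational hdelta hK pcharL hL Vr); apply: hr.
      exact: sub_adjoinl.
    apply: subset_trans (@sub_adjoinr _ _ _); apply: setUS.
    by rewrite before_rank => _ [s [_ lt_s] <-]; exists s.
  have [[q Wq qt]|/initialS_eq->//] := pselect (exists2 q, W q & rank q = t).
  rewrite -qt (adjoin_initialS u (@rank_inj n))// in IHt *.
  apply: eventually_independent_adjoin1 IHt; first exact: rank_inj.
  exact: adjoin_is_subfield.
exists (maxn B0 B) => q [alg nsep]; rewrite ltnNge geq_max; apply/negP => /andP[le_B0 le_B].
have [Wq|Vq] := pselect (W q).
  by apply: nsep; apply: separable_over_mem; [exact: adjoin_is_subfield|exact: hB0].
by apply: (hB q Vq le_B); apply: algebraic_over_sub alg; apply: preceding_field_sub.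
Qed.

End InseparableLeaders.

Theorem theorem3p1 (L : fieldType) (delta : L -> L) (K : set L) (n : nat)
    (a : 'I_n -> L)
    (hdelta : is_derivation delta)
    (hK : is_diff_subfield delta K)
    (hL : diff_adjoin delta K a = [set: L]%classic) :
  finite_set [set p | minimal_separable_leader delta K a p]%classic /\
  (separable_extension K ->
   finite_set [set p | inseparable_leader delta K a p]%classic).
Proof.
split; first exact: finite_minimal_separable_leaders.
move=> /(inseparable_leaders_bounded hdelta hK hL)[B hB].
exact: finite_rank_lt hB.
Qed.
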